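(* Let $\mathcal{A}=(Q,E,s,F)$ be an NFA and let $\mathcal{A}^*=(Q^*,E^*,s^*,F^* )$ be the powerset automaton obtained from $\mathcal{A}$. Let $n_{\preceq_\mathcal{A}}=|Q/_{\preceq_\mathcal{A}}|$ and $n^*=|Q^*|$. Let $r$ be the width of $\preceq_\mathcal{A}$ and $r^*$ the width of $\preceq_{\mathcal{A}^*}$. Then (1) $r^*\le 2^r-1$; (2) $n^*\le 2^r(n_{\preceq_\mathcal{A}}-r+1)-1$.
   Context: $\Sigma$ is a finite alphabet with a fixed total order $\preceq$, extended to $\Sigma^*$ co-lexicographically: $\alpha\preceq\beta$ iff the reverse of $\alpha$ is lexicographically $\le$ the reverse of $\beta$ ($\prec$ its strict part). An NFA is $\mathcal{A}=(Q,E,s,F)$ with finite state set $Q$, $E\subseteq Q\times Q\times\Sigma$, initial state $s$ and final states $F$; it is assumed that every state is reachable from $s$ and every state can reach a final state. $\mathcal{L}(\mathcal{A})$ is the recognized language and $Pref(\mathcal{L}(\mathcal{A}))$ its set of prefixes. For $u\in Q$, $I_u$ is the set of strings that can be read from $s$ to $u$; for $\alpha\in Pref(\mathcal{L}(\mathcal{A}))$, $I_\alpha$ is the set of states $u$ with $\alpha\in I_u$. On $\{I_u:u\in Q\}$, $\preceq$ is the reflexive relation such that for $I_u\neq I_v$: $I_u\prec I_v$ iff for all $\alpha\in I_u$, $\beta\in I_v$ with $\{\alpha,\beta\}\not\subseteq I_u\cap I_v$, $\alpha\prec\beta$. Define $u\preceq_\mathcal{A} v$ iff $I_u\preceq I_v$;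 this is a preorder on $Q$. $Q/_{\preceq_\mathcal{A}}$ is the set of equivalence classes of the relation $u\sim v$ iff $u\preceq_\mathcal{A}v$ and $v\preceq_\mathcal{A}u$. The width of a preorder is the minimum size of a partition of its ground set into sets whose elements are pairwise comparable. The powerset automaton has $Q^*=\{I_\alpha:\alpha\in Pref(\mathcal{L}(\mathcal{A}))\}$, $E^*=\{(I_\alpha,I_{\alpha a},a): \alpha a\in Pref(\mathcal{L}(\mathcal{A}))\}$, $s^*=I_\varepsilon=\{s\}$, $F^*=\{I_\alpha:\alpha\in\mathcal{L}(\mathcal{A})\}$; $\preceq_{\mathcal{A}^*}$ is defined on the DFA $\mathcal{A}^*$ in the same way as $\preceq_\mathcal{A}$ on $\mathcal{A}$. *)

(* Defs.v *)
From HB Require Import structures.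
From mathcomp Require Import all_boot all_order all_algebra.
From mathcomp Require Import boolp.

Set Implicit Arguments.
Unset Strict Implicit.
Unset Printing Implicit Defensive.

(* [seqlexi] is the lexicographic order in which a proper prefix is smaller. *)
Definition colex_lt (d : Order.disp_t) (Sigma : finOrderType d)
    (alpha beta : seq Sigma) : bool :=
  ((rev alpha : seqlexi Sigma) < (rev beta : seqlexi Sigma))%O.

(* [reads E u w v]: some path from [u] to [v] using edges of [E] is labelled
   [w]; an edge [(x, y, a)] goes from [x] to [y] with label [a]. *)
Fixpoint reads (Sigma Q : finType) (E : {set Q * Q * Sigma})
    (u : Q) (w : seq Sigma) (v : Q) : bool :=
  if w is a :: w' then [exists x, ((u, x, a) \in E) && reads E x w' v]
  else u == v.

Record nfa (Sigma : finType) : Type := Nfa {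
  state : finType;
  edges : {set state * state * Sigma};
  init : state;
  final : {set state};
  nfa_reachable : forall u, exists w, reads edges init w u;
  nfa_coreachable : forall u, exists w v, v \in final /\ reads edges u w v
}.

Definition language (Sigma : finType) (A : nfa Sigma) : pred (seq Sigma) :=
  fun w => [exists v in final A, reads (edges A) (init A) w v].

Definition pref (T : Type) (L : pred (seq T)) (alpha : seq T) : Prop :=
  exists beta, L (alpha ++ beta).

Definition Istate (Sigma : finType) (A : nfa Sigma) (u : state A) :
    pred (seq Sigma) :=
  fun w => reads (edges A) (init A) w u.

Definition Istring (Sigma : finType) (A : nfa Sigma) (alpha : seq Sigma) :
    {set state A} :=
  [set u | Istate u alpha].

Definition lang_prec (d : Order.disp_t) (Sigma : finOrderType d)
    (X Y : pred (seq Sigma)) : Prop :=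
  ~ (X =1 Y) /\
  forall alpha beta, X alpha -> Y beta ->
    ~ ((X alpha /\ Y alpha) /\ (X beta /\ Y beta)) -> colex_lt alpha beta.

Definition lang_preceq (d : Order.disp_t) (Sigma : finOrderType d)
    (X Y : pred (seq Sigma)) : Prop :=
  X =1 Y \/ lang_prec X Y.

Definition preceq (d : Order.disp_t) (Sigma : finOrderType d)
    (A : nfa Sigma) : rel (state A) :=
  fun u v => `[< lang_preceq (Istate u) (Istate v) >].

Definition preorder_quotient (T : finType) (le : rel T) : {set {set T}} :=
  equivalence_partition (fun x y => le x y && le y x) [set: T].

Definition chain (T : finType) (le : rel T) (B : {set T}) : bool :=
  [forall x in B, forall y in B, (x != y) ==> (le x y || le y x)].

Definition chain_partition (T : finType) (le : rel T) (P : {set {set T}}) :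
    bool :=
  partition P [set: T] && [forall B in P, chain le B].

Lemma chain_partition_exists (T : finType) (le : rel T) :
  exists n, [exists P, chain_partition le P && (#|P| == n)].
Proof.
exists #|equivalence_partition (@eq_op T) [set: T]|; apply/existsP.
exists (equivalence_partition (@eq_op T) [set: T]); rewrite eqxx andbT.
apply/andP; split.
  by apply: equivalence_partitionP => x y z _ _ _; split=> // /eqP->.
apply/forall_inP=> B /imsetP[x _ ->]; apply/forall_inP=> y.
rewrite !inE => /eqP<-; apply/forall_inP=> z.
by rewrite !inE => /eqP<-; rewrite eqxx.
Qed.

Definition width (T : finType) (le : rel T) : nat :=
  ex_minn (chain_partition_exists le).

Definition Qstar (Sigma : finType) (A : nfa Sigma) : {set {set state A}} :=
  [set X | `[< exists alpha, pref (language A) alpha /\ X = Istring A alpha >]].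

Definition pstate (Sigma : finType) (A : nfa Sigma) : finType :=
  {X : {set state A} | X \in Qstar A}.

Definition pedges (Sigma : finType) (A : nfa Sigma) :
    {set pstate A * pstate A * Sigma} :=
  [set e | `[< exists alpha, [/\ pref (language A) (rcons alpha e.2),
     val e.1.1 = Istring A alpha & val e.1.2 = Istring A (rcons alpha e.2)] >]].

Definition pfinal (Sigma : finType) (A : nfa Sigma) : {set pstate A} :=
  [set X | `[< exists alpha, language A alpha /\ val X = Istring A alpha >]].

Lemma pref_cat (T : Type) (L : pred (seq T)) (alpha beta : seq T) :
  pref L (alpha ++ beta) -> pref L alpha.
Proof. by case=> gamma Lg; exists (beta ++ gamma); rewrite catA. Qed.

Lemma Istring_Qstar (Sigma : finType) (A : nfa Sigma) (alpha : seq Sigma) :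
  pref (language A) alpha -> Istring A alpha \in Qstar A.
Proof. by move=> pA; rewrite inE; apply/asboolP; exists alpha. Qed.

Definition pstate_of (Sigma : finType) (A : nfa Sigma) (alpha : seq Sigma)
    (pA : pref (language A) alpha) : pstate A :=
  exist (fun X => X \in Qstar A) (Istring A alpha) (Istring_Qstar pA).

Lemma pref_nil (Sigma : finType) (A : nfa Sigma) : pref (language A) [::].
Proof.
have [w [v [vF rw]]] := nfa_coreachable (init A).
by exists w; apply/exists_inP; exists v.
Qed.

Definition pinit (Sigma : finType) (A : nfa Sigma) : pstate A :=
  pstate_of (pref_nil A).

Lemma preads (Sigma : finType) (A : nfa Sigma) (alpha beta : seq Sigma)
    (X Y : pstate A) :
  pref (language A) (alpha ++ beta) ->
  val X = Istring A alpha -> val Y = Istring A (alpha ++ beta) ->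
  reads (pedges A) X beta Y.
Proof.
elim: beta alpha X => [|a beta IH] alpha X pA vX vY /=.
  by apply/eqP/val_inj; rewrite vX vY cats0.
rewrite -cat_rcons in pA vY.
apply/existsP; exists (pstate_of (pref_cat pA)).
rewrite (IH (rcons alpha a)) // andbT inE; apply/asboolP.
by exists alpha; split=> //=; apply: pref_cat pA.
Qed.

Lemma preachable (Sigma : finType) (A : nfa Sigma) (X : pstate A) :
  exists w, reads (pedges A) (pinit A) w X.
Proof.
have := valP X; rewrite inE => /asboolP[alpha [pA vX]].
by exists alpha; apply: (@preads _ _ [::]).
Qed.

Lemma pcoreachable (Sigma : finType) (A : nfa Sigma) (X : pstate A) :
  exists w Y, Y \in pfinal A /\ reads (pedges A) X w Y.
Proof.
have := valP X; rewrite inE => /asboolP[alpha [[beta Lab] vX]].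
have pab : pref (language A) (alpha ++ beta) by exists [::]; rewrite cats0.
exists beta, (pstate_of pab); split; last exact: preads vX _.
by rewrite inE; apply/asboolP; exists (alpha ++ beta).
Qed.

Definition powerset_nfa (Sigma : finType) (A : nfa Sigma) : nfa Sigma :=
  Nfa (@preachable _ A) (@pcoreachable _ A).

(* Main.v *)
(* Fix a minimum partition of the states into chains, arranged so that states
   with the same [I_u] share a chain, and let the support of a set of states be
   the set of chains it meets.  If [I_alpha] and [I_beta] are distinct but have
   the same support, some chain contains states [u] in [I_alpha] and [w] in
   [I_beta] with [I_u <> I_w]; comparing [u] and [w] fixes the order of every
   string of the class of [alpha] against every string of the class of [beta].
   Hence each of the [2 ^ r - 1] nonempty supports yields a chain of the powerset
   automaton, which is (1).

   For (2), fix a support [K] and let [T_K] be the [I]-classes lying on the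
   chains of [K].  Reading strings co-lexicographically, the number of classes
   of [T_K] that have been entered plus the number that have been left strictly
   increases along the sets [I_alpha] of support [K].  As [I_alpha] always
   meets all [#|K|] chains, this potential lies between [#|K|] and
   [2 * #|T_K| - #|K|].  Summing over [K], each chain is in half of the supports. *)

Require Import Defs.
From mathcomp Require Import all_boot all_order all_algebra.
From mathcomp Require Import boolp zify.

Import Order.TTheory.

Set Implicit Arguments.
Unset Strict Implicit.
Unset Printing Implicit Defensive.

(** * Counting tools and the width of a relation *)

Lemma card_in_interval (T : finType) (A : {set T}) (h : T -> nat) (a b : nat) :
  {in A &, injective h} -> (forall x, x \in A -> a <= h x <= b) -> a <= b.+1 ->
  #|A| + a <= b.+1.
Proof.
move=> h_inj h_ab le_ab.
suff: #|A| <= b.+1 - a by lia.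
rewrite cardE -(size_map h) -(size_iota a (b.+1 - a)); apply: uniq_leq_size.
  rewrite map_inj_in_uniq ?enum_uniq // => x y; rewrite !mem_enum; exact: h_inj.
move=> _ /mapP[x + ->]; rewrite mem_enum mem_iota => /h_ab; lia.
Qed.

(* Pair each [K] with its complement. *)
Lemma sum_card_preim_sets (T I : finType) (A : {set T}) (f : T -> I) :
  2 * \sum_(K : {set I}) #|[set x in A | f x \in K]| = 2 ^ #|I| * #|A|.
Proof.
rewrite mul2n -addnn {2}(reindex_inj (inv_inj (@setCK I))) -big_split /=.
have cardK (K : {set I}) :
    #|[set x in A | f x \in K]| + #|[set x in A | f x \in ~: K]| = #|A|.
  rewrite -(cardsID [set x | f x \in K] A); congr (_ + _); apply: eq_card => x.
    by rewrite !inE.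
  by rewrite !inE andbC.
rewrite (eq_bigr _ (fun K _ => cardK K)) sum_nat_const.
by rewrite -cardsT -powersetT card_powerset cardsT.
Qed.

Lemma width_leq_card (T : finType) (le : rel T) (P : {set {set T}}) :
  chain_partition le P -> width le <= #|P|.
Proof.
move=> cP; rewrite /width; case: ex_minnP => m _; apply.
by apply/existsP; exists P; rewrite cP eqxx.
Qed.

Lemma width_attained (T : finType) (le : rel T) :
  exists2 P, chain_partition le P & #|P| = width le.
Proof.
rewrite /width; case: ex_minnP => m /existsP[P /andP[cP /eqP cardP]] _.
by exists P.
Qed.

(** The fibres of [h] form a partition into chains, one for each colour attained. *)
Lemma width_leq_colouring (T I : finType) (le : rel T) (h : T -> I) :
  (forall x y, h x = h y -> x != y -> le x y || le y x) ->
  width le <= #|h @: setT|.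
Proof.
move=> h_chain.
apply: (@leq_trans #|preim_partition h setT|).
  apply: width_leq_card; rewrite /chain_partition preim_partitionP /=.
  apply/forall_inP=> _ /imsetP[x _ ->].
  apply/forall_inP=> y; rewrite !inE /= => /eqP hxy.
  apply/forall_inP=> z; rewrite !inE /= => /eqP hxz.
  by apply/implyP; apply: h_chain; rewrite -hxy.
have -> : preim_partition h setT =
    (fun k => [set y in [set: T] | k == h y]) @: (h @: setT).
  by rewrite -imset_comp.
exact: leq_imset_card.
Qed.

(** * Comparing languages co-lexicographically *)

Section Colex.

Variables (d : Order.disp_t) (Sigma : finOrderType d).
Implicit Types (alpha beta gamma : seq Sigma) (X Y : pred (seq Sigma)).

Lemma colex_lt_trans beta alpha gamma :
  colex_lt alpha beta -> colex_lt beta gamma -> colex_lt alpha gamma.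
Proof. exact: lt_trans. Qed.

Lemma colex_ltxx alpha : colex_lt alpha alpha = false.
Proof. exact: ltxx. Qed.

Lemma colex_lt_asym alpha beta : colex_lt alpha beta -> ~~ colex_lt beta alpha.
Proof. by move=> lt_ab; apply/negP => /(colex_lt_trans lt_ab); rewrite colex_ltxx. Qed.

Lemma colex_lt_total alpha beta :
  alpha != beta -> colex_lt alpha beta || colex_lt beta alpha.
Proof.
move=> neq_ab; apply: lt_total.
by apply: contraNneq neq_ab => /(can_inj revK)->.
Qed.

(** By [sep], the languages differ and the pair [alpha], [beta] is not exempt from comparison;
    [lang_prec Y X] would then put [beta] before [alpha]. *)
Lemma lang_prec_separated X Y alpha beta :
  lang_preceq X Y \/ lang_preceq Y X -> X alpha -> Y beta ->
  ~~ X beta \/ ~~ Y alpha -> colex_lt alpha beta -> lang_prec X Y.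
Proof.
move=> cmpXY Xa Yb sep lt_ab.
have neqXY : ~ X =1 Y.
  by move=> eqXY; case: sep; [rewrite eqXY Yb|rewrite -eqXY Xa].
have ltYX : ~ lang_prec Y X.
  case=> _ /(_ _ _ Yb Xa) lt_ba; move: (colex_lt_asym lt_ab).
  by rewrite lt_ba // => -[[_ Xb] [Ya _]]; case: sep; rewrite ?Xb ?Ya.
by case: cmpXY => -[] // eqYX; case: neqXY => x; rewrite eqYX.
Qed.

(** A string in just one of the languages and any string of the other would be compared in both
    directions. *)
Lemma lang_preceq_anti X Y :
  (exists alpha, X alpha) -> (exists beta, Y beta) ->
  lang_preceq X Y -> lang_preceq Y X -> X =1 Y.
Proof.
move=> [alpha Xa] [beta Yb] [//|[neqXY ltXY]] [eqYX|[_ ltYX]].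
  by move=> x; rewrite eqYX.
case: neqXY => x; apply/idP/idP => [Xx|Yx].
- apply/negPn/negP => nYx.
  have lt_xb : colex_lt x beta by apply: ltXY => // -[[_ Yx] _]; rewrite Yx in nYx.
  have lt_bx : colex_lt beta x by apply: ltYX => // -[_ [Yx _]]; rewrite Yx in nYx.
  by move: (colex_lt_asym lt_xb); rewrite lt_bx.
- apply/negPn/negP => nXx.
  have lt_ax : colex_lt alpha x by apply: ltXY => // -[_ [Xx _]]; rewrite Xx in nXx.
  have lt_xa : colex_lt x alpha by apply: ltYX => // -[[_ Xx] _]; rewrite Xx in nXx.
  by move: (colex_lt_asym lt_ax); rewrite lt_xa.
Qed.

End Colex.

(** * Reading strings in an automaton and in its powerset *)

Section Reading.

Variables (Sigma : finType) (A : nfa Sigma).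
Implicit Types (alpha beta w : seq Sigma).

Lemma reads_cat (Q : finType) (E : {set Q * Q * Sigma}) (u v : Q) w1 w2 :
  reads E u (w1 ++ w2) v = [exists x, reads E u w1 x && reads E x w2 v].
Proof.
elim: w1 u => [|a w1 IH] u /=.
  apply/idP/existsP => [r2|[x /andP[/eqP-> //]]].
  by exists u; rewrite eqxx.
apply/existsP/existsP => [[y /andP[uy]]|[x /andP[/existsP[y /andP[uy yx]] xv]]].
  rewrite IH => /existsP[x /andP[yx xv]]; exists x; rewrite xv andbT.
  by apply/existsP; exists y; rewrite uy.
by exists y; rewrite uy IH; apply/existsP; exists x; rewrite yx.
Qed.

Lemma prefP alpha : pref (language A) alpha <-> exists u, u \in Istring A alpha.
Proof.
split=> [[beta /exists_inP[v _]]|[u]].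
  by rewrite reads_cat => /existsP[x /andP[rx _]]; exists x; rewrite inE.
rewrite inE => ru; have [w [v [vF rw]]] := nfa_coreachable u.
exists w; apply/exists_inP; exists v => //.
by rewrite reads_cat; apply/existsP; exists u; rewrite [X in X && _]ru.
Qed.

Lemma eq_Istring_cat alpha beta w :
  Istring A alpha = Istring A beta ->
  Istring A (alpha ++ w) = Istring A (beta ++ w).
Proof.
move=> /setP eqI; apply/setP => v; rewrite !inE /Istate !reads_cat.
by apply: eq_existsb => x; have := eqI x; rewrite !inE /Istate => ->.
Qed.

Lemma Istate_powerset w (X : pstate A) :
  @Istate Sigma (powerset_nfa A) X w -> val X = Istring A w.
Proof.
rewrite /Istate /=.
have gen (Y : pstate A) alpha : val Y = Istring A alpha ->
    reads (pedges A) Y w X -> val X = Istring A (alpha ++ w).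
  elim: w Y alpha => [|a w IH] Y alpha eqY /=.
    by move/eqP<-; rewrite cats0.
  (* The edge may be witnessed by a string [beta] other than [alpha]; both reach the same set, so
     they still do after appending [a]. *)
  case/existsP=> Z /andP[]; rewrite inE => /asboolP[beta /= [_ eqYb eqZ]].
  rewrite -cat_rcons; apply: IH; rewrite [LHS]eqZ -!cats1; apply: eq_Istring_cat.
  by rewrite -eqYb.
exact: (gen (pinit A) [::]).
Qed.

End Reading.

(** * Classes of states with equal language, and chain colourings *)

Section Supports.

Variables (d : Order.disp_t) (Sigma : finOrderType d) (A : nfa Sigma).
Local Notation Q := (state A).
Local Notation le := (@preceq d Sigma A).
Implicit Types (u v w : Q) (alpha beta gamma : seq Sigma).

Lemma preceq_antiP u v : reflect (Istate u =1 Istate v) (le u v && le v u).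
Proof.
apply: (iffP andP) => [[/asboolP uv /asboolP vu]|eq_uv].
  by apply: lang_preceq_anti uv vu; apply: nfa_reachable.
by split; apply/asboolP; left=> // x; rewrite eq_uv.
Qed.

(** Since [pick] depends only on the predicate's values, equivalent states get the same
    representative. The default is never reached, as [u] itself qualifies. *)
Definition class_repr u : Q := odflt u [pick v | le u v && le v u].

Lemma Istate_class_repr u : Istate (class_repr u) =1 Istate u.
Proof.
rewrite /class_repr; case: pickP => //= v /preceq_antiP eq_uv x.
by rewrite eq_uv.
Qed.

Lemma class_repr_eq u v : Istate u =1 Istate v -> class_repr u = class_repr v.
Proof.
move=> eq_uv; rewrite /class_repr.
have -> : [pick w | le u w && le w u] = [pick w | le v w && le w v].
  apply: eq_pick => w; apply/preceq_antiP/preceq_antiP => eq_w x.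
    by rewrite -eq_uv.
  by rewrite eq_uv.
by case: pickP => //= /(_ v) /preceq_antiP[].
Qed.

Definition class_reprs : {set Q} := class_repr @: setT.

(** The block of a state depends only on its representative, and distinct representatives have
    distinct blocks. *)
Lemma card_class_reprs : #|class_reprs| = #|preorder_quotient le|.
Proof.
rewrite /preorder_quotient /equivalence_partition.
have block_repr u : [set y in setT | le u y && le y u] =
                    [set y in setT | le (class_repr u) y && le y (class_repr u)].
  apply/setP => y; rewrite !inE /=.
  by apply/preceq_antiP/preceq_antiP => eq_y x;
     rewrite -eq_y Istate_class_repr.
rewrite (eq_imset _ block_repr).
rewrite (imset_comp (fun c => [set y in setT | le c y && le y c]) class_repr).
rewrite [RHS]card_in_imset // => _ _ /imsetP[u _ ->] /imsetP[v _ ->] /setP.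
move=> /(_ (class_repr v)); rewrite !inE /=.
have -> : le (class_repr v) (class_repr v) by apply/asboolP; left.
move=> /preceq_antiP eq_uv; apply: class_repr_eq => x.
by rewrite -Istate_class_repr eq_uv Istate_class_repr.
Qed.

(** A chain partition as a map: [f u] names the chain of [u], equivalent states share a chain, and
    no chain is empty. *)
Definition chain_colouring (I : finType) (f : Q -> I) : Prop :=
  [/\ forall u v, f u = f v ->
        lang_preceq (Istate u) (Istate v) \/ lang_preceq (Istate v) (Istate u),
      forall u, f (class_repr u) = f u
    & forall i, exists u, f u = i].

(* Recolouring each state like its representative may only lose colours, and by
   minimality loses none. *)
Lemma minimum_chain_colouring :
  exists (I : finType) (f : Q -> I), #|I| = width le /\ chain_colouring f.
Proof.
have [P /andP[partP /forall_inP chainP] cardP] := width_attained le.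
pose g u := pblock P (class_repr u).
have coverP u : u \in cover P by rewrite (cover_partition partP) inE.
have g_chain u v : g u = g v ->
    lang_preceq (Istate u) (Istate v) \/ lang_preceq (Istate v) (Istate u).
  move=> eq_g; have := chainP _ (pblock_mem (coverP (class_repr u))).
  move=> /forall_inP /(_ (class_repr u)); rewrite mem_pblock coverP => /(_ isT).
  move=> /forall_inP /(_ (class_repr v)).
  rewrite -/(g u) eq_g mem_pblock coverP => /(_ isT).
  have eqI w : Istate (class_repr w) = Istate w.
    by apply/funext/Istate_class_repr.
  case: eqVneq => [eq_uv _|_ /=].
    by left; left; rewrite -(eqI u) eq_uv eqI.
  by case/orP=> /asboolP; rewrite !eqI; [left|right].
have le_gP : #|g @: setT| <= #|P|.
  apply: subset_leq_card; apply/subsetP => _ /imsetP[u _ ->].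
  exact: pblock_mem.
have le_wg : width le <= #|g @: setT|.
  apply: width_leq_colouring => u v /g_chain[] uv _; apply/orP.
    by left; apply/asboolP.
  by right; apply/asboolP.
pose I : finType := {B : {set Q} | B \in g @: setT}.
have gI u : g u \in g @: setT by rewrite imset_f ?inE.
exists I, (fun u => exist (fun B => B \in g @: setT) (g u) (gI u)); split.
  rewrite card_sig; apply/eqP; rewrite eqn_leq -{1}cardP.
  by rewrite le_gP.
split=> [u v /(congr1 val) /g_chain //|u|[B gB]].
  by apply: val_inj; rewrite /= /g (class_repr_eq (Istate_class_repr u)).
by have /imsetP[u _ eqB] := gB; exists u; apply: val_inj; rewrite /= eqB.
Qed.

(** * Sets of states with equal support *)

Variables (I : finType) (f : Q -> I).
Hypothesis col_f : chain_colouring f.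

(** Equal supports provide a state [w] of [Istring A beta] on the chain of [u]; being comparable,
    the two are ordered by [alpha] and [beta]. *)
Lemma same_support_lt alpha beta u :
  f @: Istring A alpha = f @: Istring A beta -> colex_lt alpha beta ->
  Istate u alpha -> ~~ Istate u beta ->
  exists2 w : Q, Istate w beta & lang_prec (Istate u) (Istate w).
Proof.
move=> eq_supp lt_ab ua ub; have [f_chain _ _] := col_f.
have: f u \in f @: Istring A beta by rewrite -eq_supp imset_f ?inE.
case/imsetP=> w; rewrite inE => wb fuw; exists w => //.
by apply: (lang_prec_separated (f_chain _ _ fuw) ua wb _ lt_ab); left.
Qed.

Lemma same_support_gt alpha beta u :
  f @: Istring A alpha = f @: Istring A beta -> colex_lt alpha beta ->
  ~~ Istate u alpha -> Istate u beta ->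
  exists2 w : Q, Istate w alpha & lang_prec (Istate w) (Istate u).
Proof.
move=> eq_supp lt_ab ua ub; have [f_chain _ _] := col_f.
have: f u \in f @: Istring A alpha by rewrite eq_supp imset_f ?inE.
case/imsetP=> w; rewrite inE => wa /esym fuw; exists w => //.
by apply: (lang_prec_separated (f_chain _ _ fuw) wa ub _ lt_ab); right.
Qed.

Lemma neq_IstringP alpha beta :
  Istring A alpha != Istring A beta ->
  exists u : Q, (Istate u alpha /\ ~~ Istate u beta) \/
            (~~ Istate u alpha /\ Istate u beta).
Proof.
move=> neqI; apply: contrapT => eqI; move/eqP: neqI; apply.
apply/setP => u; rewrite !inE.
case: (boolP (Istate u alpha)) (boolP (Istate u beta)) => ua [] ub //.
  by case: eqI; exists u; left.
by case: eqI; exists u; right.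
Qed.

(** The two states ordered through [alpha] and [beta] are also reached by [alpha'] and [beta']
    respectively, and one of them still separates these strings. *)
Lemma same_support_class_lt alpha beta alpha' beta' :
  f @: Istring A alpha = f @: Istring A beta -> colex_lt alpha beta ->
  Istring A alpha != Istring A beta ->
  Istring A alpha' = Istring A alpha -> Istring A beta' = Istring A beta ->
  colex_lt alpha' beta'.
Proof.
move=> eq_supp lt_ab /neq_IstringP[u sep] /setP eq_a /setP eq_b.
have Ia w : Istate w alpha' = Istate w alpha by have := eq_a w; rewrite !inE.
have Ib w : Istate w beta' = Istate w beta by have := eq_b w; rewrite !inE.
case: sep => -[ua ub].
  have [w wb [_ lt_uw]] := same_support_lt eq_supp lt_ab ua ub.
  by apply: lt_uw; rewrite ?Ia ?Ib // => -[_ [ub' _]]; rewrite ub' in ub.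
have [w wa [_ lt_wu]] := same_support_gt eq_supp lt_ab ua ub.
by apply: lt_wu; rewrite ?Ia ?Ib // => -[[_ ua'] _]; rewrite ua' in ua.
Qed.

(** * The width of the powerset automaton *)

Lemma Qstar_Istring (X : {set Q}) :
  X \in Qstar A ->
  exists alpha, X = Istring A alpha /\ exists u, u \in Istring A alpha.
Proof. by rewrite inE => /asboolP[alpha [/prefP ne ->]]; exists alpha. Qed.

Lemma width_powerset : (width (@preceq d Sigma (powerset_nfa A))).+1 <= 2 ^ #|I|.
Proof.
pose h (X : state (powerset_nfa A)) := f @: val X.
apply: (@leq_ltn_trans #|h @: setT|).
  apply: width_leq_colouring => X Y eq_h neqXY.
  have [alpha [eqX _]] := Qstar_Istring (valP X).
  have [beta [eqY _]] := Qstar_Istring (valP Y).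
  have neqI : Istring A alpha != Istring A beta.
    by apply: contraNneq neqXY => eqI; apply/eqP/val_inj; rewrite eqX eqY.
  have nXY : ~ @Istate Sigma (powerset_nfa A) X =1 @Istate Sigma (powerset_nfa A) Y.
    have [w Xw] := @nfa_reachable _ (powerset_nfa A) X.
    move/(_ w); rewrite [LHS]Xw => /esym/Istate_powerset eqYw.
    move/Istate_powerset: Xw => eqXw.
    by move/eqP: neqXY; apply; apply: val_inj; rewrite eqXw eqYw.
  have neq_ab : alpha != beta by apply: contraNneq neqI => ->.
  rewrite /h eqX eqY in eq_h.
  case/orP: (colex_lt_total neq_ab) => lt_ab; apply/orP; [left|right];
    apply/asboolP; right; split.
  - exact: nXY.
  - move=> alpha' beta' /Istate_powerset eqa /Istate_powerset eqb _.
    by apply: same_support_class_lt eq_h lt_ab neqI _ _; rewrite -?eqa -?eqb.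
  - by move=> eqYX; apply: nXY => x; rewrite eqYX.
  - move=> beta' alpha' /Istate_powerset eqb /Istate_powerset eqa _.
    rewrite eq_sym in neqI.
    by apply: same_support_class_lt (esym eq_h) lt_ab neqI _ _;
       rewrite -?eqa -?eqb.
(* The empty support is never attained, which gives the strict inequality. *)
rewrite -cardsT -card_powerset; apply: proper_card; rewrite properE.
rewrite powersetT subsetT /=; apply/subsetPn; exists set0; rewrite ?inE //.
apply/imsetP => -[X _ /esym/eqP]; rewrite imset_eq0.
have [alpha [-> [u uX]]] := Qstar_Istring (valP X).
by move/eqP=> X0; rewrite X0 inE in uX.
Qed.

(** * The potential along sets of a fixed support *)

Definition classes_of (K : {set I}) : {set Q} := [set u in class_reprs | f u \in K].

(** Non-strict here but strict in [left_behind]: a class containing [alpha] itself is entered and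
    not yet left. *)
Definition entered (K : {set I}) alpha : {set Q} :=
  [set u in classes_of K | `[< exists2 gamma, Istate u gamma & ~~ colex_lt alpha gamma >]].

Definition left_behind (K : {set I}) alpha : {set Q} :=
  [set u in classes_of K | `[< forall gamma, Istate u gamma -> colex_lt gamma alpha >]].

Lemma entered_mono K alpha beta :
  colex_lt alpha beta -> entered K alpha \subset entered K beta.
Proof.
move=> lt_ab; apply/subsetP => u; rewrite !in_set => /andP[-> /asboolP[gamma ug na]].
apply/asboolP; exists gamma => //.
by apply: contra na => /(colex_lt_trans lt_ab).
Qed.

Lemma left_behind_mono K alpha beta :
  colex_lt alpha beta -> left_behind K alpha \subset left_behind K beta.
Proof.
move=> lt_ab; apply/subsetP => u; rewrite !in_set => /andP[-> /asboolP lt_u].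
by apply/asboolP => gamma /lt_u lt_ga; apply: colex_lt_trans lt_ab.
Qed.

Lemma Istring_class_repr alpha u :
  (class_repr u \in Istring A alpha) = (u \in Istring A alpha).
Proof. by rewrite !inE Istate_class_repr. Qed.

Lemma classes_of_repr K u : (class_repr u \in classes_of K) = (f u \in K).
Proof. by have [_ fc _] := col_f; rewrite inE fc imset_f ?inE. Qed.

Lemma card_support_leq K alpha :
  f @: Istring A alpha = K -> #|K| <= #|classes_of K :&: Istring A alpha|.
Proof.
move=> suppK; apply: leq_trans (leq_imset_card f _).
apply: subset_leq_card; apply/subsetP => i iK; have: i \in K by [].
rewrite -{1}suppK => /imsetP[u ua eq_i]; apply/imsetP.
have [_ fc _] := col_f; exists (class_repr u); last by rewrite fc.
by rewrite in_setI classes_of_repr Istring_class_repr ua -eq_i iK.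
Qed.

(** The classes [W] containing [alpha] number at least [#|K|]; all of them are entered and none is
    left. *)
Lemma potential_bounds K alpha :
  f @: Istring A alpha = K ->
  #|K| <= #|entered K alpha| + #|left_behind K alpha| /\
  #|entered K alpha| + #|left_behind K alpha| + #|K| <= 2 * #|classes_of K|.
Proof.
move=> suppK; have leK := card_support_leq suppK.
set W := _ :&: _ in leK.
have sWE : W \subset entered K alpha.
  apply/subsetP => u; rewrite !in_set => /andP[-> ua].
  by apply/asboolP; exists alpha; rewrite ?colex_ltxx.
have sET : entered K alpha \subset classes_of K.
  by apply/subsetP => u; rewrite in_set => /andP[].
have sLT : left_behind K alpha \subset classes_of K :\: W.
  apply/subsetP => u; rewrite /left_behind in_set => /andP[uT /asboolP lt_u].
  rewrite in_setD uT andbT; apply/negP; rewrite !in_set => /andP[_ /lt_u].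
  by rewrite colex_ltxx.
have /eqP := cardsID W (classes_of K).
rewrite (setIidPr (subsetIl _ _)) -/W => /eqP.
move: (subset_leq_card sWE) (subset_leq_card sET) (subset_leq_card sLT); lia.
Qed.

(** Both counts are monotone. A class containing only [alpha] is newly left at [beta]; one
    containing only [beta] is newly entered. *)
Lemma potential_lt alpha beta K :
  f @: Istring A alpha = K -> f @: Istring A beta = K ->
  Istring A alpha != Istring A beta -> colex_lt alpha beta ->
  #|entered K alpha| + #|left_behind K alpha| <
  #|entered K beta| + #|left_behind K beta|.
Proof.
move=> suppa suppb /neq_IstringP[u0 sep] lt_ab.
have subE := entered_mono K lt_ab; have subL := left_behind_mono K lt_ab.
have eq_supp : f @: Istring A alpha = f @: Istring A beta by rewrite suppa.
pose u := class_repr u0.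
have Iu gamma : Istate u gamma = Istate u0 gamma by apply: Istate_class_repr.
rewrite -!Iu in sep.
have uK : u \in classes_of K.
  rewrite classes_of_repr; case: sep => -[].
    by rewrite -suppa Iu => ua _; rewrite imset_f ?inE.
  by rewrite -suppb !Iu => _ ub; rewrite imset_f ?inE.
case: sep => -[ua ub].
  have [w wb [_ lt_uw]] := same_support_lt eq_supp lt_ab ua ub.
  suff ltL : left_behind K alpha \proper left_behind K beta.
    by rewrite -addnS leq_add ?proper_card ?subset_leq_card.
  rewrite properE subL; apply/subsetPn; exists u.
    rewrite in_set uK; apply/asboolP => gamma ug.
    by apply: lt_uw => // -[_ [ub' _]]; rewrite ub' in ub.
  by rewrite in_set uK; apply/asboolP => /(_ _ ua); rewrite colex_ltxx.
have [w wa [_ lt_wu]] := same_support_gt eq_supp lt_ab ua ub.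
suff ltE : entered K alpha \proper entered K beta.
  by rewrite -addSn leq_add ?proper_card ?subset_leq_card.
rewrite properE subE; apply/subsetPn; exists u.
  by rewrite in_set uK; apply/asboolP; exists beta; rewrite ?colex_ltxx.
rewrite in_set uK; apply/asboolP => -[gamma ug /negP]; apply.
by apply: lt_wu => // -[[_ ua'] _]; rewrite ua' in ua.
Qed.

Lemma card_same_support K :
  #|[set X in Qstar A | f @: X == K]| + 2 * #|K| <= (2 * #|classes_of K|).+1.
Proof.
(* One string is chosen per set, making the potential a function of the set. *)
have [str strP] : {str : {set Q} -> seq Sigma &
    forall X, X \in Qstar A -> X = Istring A (str X)}.
  apply: (@choice _ _ (fun X alpha => X \in Qstar A -> X = Istring A alpha)).
  move=> X; case: (boolP (X \in Qstar A)) => [/Qstar_Istring[alpha [-> _]]|_].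
    by exists alpha.
  by exists [::].
(* Adding [#|K|] makes the range run from [2 * #|K|] to [2 * #|classes_of K|], without
   subtraction. *)
pose pot X := #|entered K (str X)| + #|left_behind K (str X)| + #|K|.
apply: (card_in_interval (h := pot)) => [X Y|X|].
- rewrite in_set => /andP[XQ /eqP suppX]; rewrite in_set => /andP[YQ /eqP suppY].
  move=> /eqP; rewrite eqn_add2r => /eqP eq_pot.
  have eqX := strP X XQ; have eqY := strP Y YQ.
  apply/eqP/negPn/negP; rewrite eqX eqY => neqI.
  have neq_str : str X != str Y by apply: contraNneq neqI => ->.
  rewrite eqX in suppX; rewrite eqY in suppY.
  case/orP: (colex_lt_total neq_str) => lt_str.
    by have := potential_lt suppX suppY neqI lt_str; rewrite eq_pot ltnn.
  rewrite eq_sym in neqI.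
  by have := potential_lt suppY suppX neqI lt_str; rewrite eq_pot ltnn.
- rewrite in_set => /andP[XQ /eqP]; rewrite {1}(strP X XQ) => /potential_bounds.
  by rewrite /pot; lia.
(* [K] may be the support of no set in [Qstar A], so this uses surjectivity of [f]. *)
- suff: #|K| <= #|classes_of K| by lia.
  apply: leq_trans (leq_imset_card f _); apply: subset_leq_card.
  apply/subsetP => i iK; have [_ fc /(_ i)[u fu]] := col_f.
  by apply/imsetP; exists (class_repr u); rewrite ?fc // classes_of_repr fu.
Qed.

(** Subtraction-free form of the second bound, obtained by summing [card_same_support] over all
    [K]. *)
Lemma card_Qstar : #|Qstar A| + 2 ^ #|I| * #|I| < 2 ^ #|I| * #|class_reprs| + 2 ^ #|I|.
Proof.
have cardQ : #|Qstar A| = \sum_(K : {set I}) #|[set X in Qstar A | f @: X == K]|.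
  rewrite -sum1_card (partition_big (fun X : {set Q} => f @: X) predT) //=.
  by apply: eq_bigr => K _; rewrite -sum1_card; apply: eq_bigl => X; rewrite !in_set.
have sumK : 2 * \sum_(K : {set I}) #|K| = 2 ^ #|I| * #|I|.
  rewrite -{2}(cardsT I) -(sum_card_preim_sets setT id); congr (2 * _).
  by apply: eq_bigr => K _; apply: eq_card => i; rewrite !inE.
rewrite -sumK -(sum_card_preim_sets class_reprs f) cardQ.
have -> : 2 ^ #|I| = \sum_(K : {set I}) 1.
  by rewrite sum_nat_const muln1 -[RHS]cardsT -powersetT card_powerset cardsT.
rewrite !big_distrr /= -!big_split /=.
(* The empty support is split off: no set has it, so its term is strict, whence the final -1. *)
rewrite (bigD1 (set0 : {set I})) // [ltnRHS](bigD1 (set0 : {set I})) //=.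
rewrite -addSn leq_add //; last first.
  by apply: leq_sum => K _; rewrite addn1; apply: card_same_support.
have -> : [set X in Qstar A | f @: X == set0] = set0.
  apply/setP => X; rewrite in_set in_set0; apply/negP.
  move=> /andP[/Qstar_Istring[alpha [-> [u uX]]]].
  by rewrite imset_eq0 => /eqP X0; rewrite X0 inE in uX.
by rewrite !cards0 addn1.
Qed.

End Supports.

(** * The two bounds over the integers *)

Unset Implicit Arguments.

Theorem theorem9 (d : Order.disp_t) (Sigma : finOrderType d) (A : nfa Sigma)
    (n nstar r rstar : nat) :
  n = #|preorder_quotient (@preceq d Sigma A)| ->
  nstar = #|Qstar A| ->
  r = width (@preceq d Sigma A) ->
  rstar = width (@preceq d Sigma (powerset_nfa A)) ->
  (rstar%:Z <= 2%:Z ^+ r - 1)%R /\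
  (nstar%:Z <= 2%:Z ^+ r * (n%:Z - r%:Z + 1) - 1)%R.
Proof.
move=> -> -> -> ->.
have [I [f [cardI col_f]]] := minimum_chain_colouring A.
have := width_powerset col_f; have := card_Qstar col_f.
rewrite cardI card_class_reprs.
have -> : (2%:Z ^+ width (@preceq d Sigma A))%R = Posz (2 ^ width (@preceq d Sigma A)).
  by rewrite -[RHS]natz GRing.natrX natz.
move: (2 ^ _) => p lt_n lt_r; split; first lia.
by rewrite GRing.mulrDr GRing.mulrBr GRing.mulr1 -!PoszM; lia.
Qed.
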